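(* Let $A,M$ be square matrices such that $M$ is invertible and $M^{-1}A$ is diagonalizable. Consider the left and right generalized eigenvectors, $V_l$ and $V_r$, respectively, of the matrix pencil $(A,M)$, defined such that $$AV_r=MV_r\Lambda,\qquad V_l^*A=\Lambda V_l^*M,$$ where $\Lambda$ is a diagonal matrix of eigenvalues. Then $V_l$ and $V_r$ induce a matrix-based orthogonality, satisfying $$V_l^*AV_r=D_a,\qquad V_l^*MV_r=D_m$$ for diagonal matrices $D_a,D_m$.
   Context: $A,M\in\mathbb{C}^{n\times n}$ and $(\cdot)^*$ denotes the conjugate transpose. The columns of $V_r\in\mathbb{C}^{n\times n}$ and of $V_l\in\mathbb{C}^{n\times n}$ are full sets of $n$ linearly independent right and left generalized eigenvectors, respectively, and $\Lambda$ is the same diagonal matrix in both equations.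
   Formalization: For arbitrary V_l, V_r the claim fails with repeated eigenvalues; it is proved for distinct eigenvalues, and in general as vanishing of entries across distinct eigenvalues and existence, for any given V_r (or V_l) and Λ, of a V_l (or V_r) making both products diagonal. *)

(* Defs.v *)
From mathcomp Require Import all_boot all_order all_algebra.
From mathcomp Require Import complex reals.

Set Implicit Arguments.
Unset Strict Implicit.
Unset Printing Implicit Defensive.

Import Order.TTheory GRing.Theory Num.Theory.

Local Open Scope ring_scope.
Local Open Scope sesquilinear_scope.

Section GeneralizedEigenvectors.
Variables (C : numClosedFieldType) (n : nat).
Implicit Types A M V Vl Vr L : 'M[C]_n.

(* Eigenvectors are the columns of V; [V \in unitmx] says that they form a
   full linearly independent set. *)
Definition right_eigenvectors A M L V : Prop :=
  [/\ V \in unitmx, is_diag_mx L & A *m V = M *m V *m L].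

Definition left_eigenvectors A M L V : Prop :=
  [/\ V \in unitmx, is_diag_mx L & V^t* *m A = L *m V^t* *m M].

Definition biorthogonal A M Vl Vr : Prop :=
  exists Da Dm : 'M[C]_n,
    [/\ is_diag_mx Da, is_diag_mx Dm,
        Vl^t* *m A *m Vr = Da & Vl^t* *m M *m Vr = Dm].

End GeneralizedEigenvectors.

(* Main.v *)
(* Both sides of [W A V], with [W] the conjugate transpose of [Vl], show that
   the Gram matrix [W M V] commutes with [L], so that its entries vanish across
   distinct eigenvalues.  For repeated eigenvalues, one eigenbasis determines a
   dual one through the normalization [W M V = 1], which turns the right
   eigenvector equation into the left one and conversely. *)

Require Import Defs.
From mathcomp Require Import all_boot all_order all_algebra.
From mathcomp Require Import complex reals.

Set Implicit Arguments.
Unset Strict Implicit.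
Unset Printing Implicit Defensive.

Import Order.TTheory GRing.Theory Num.Theory.

Local Open Scope ring_scope.
Local Open Scope sesquilinear_scope.
Local Open Scope complex_scope.

Section DualEigenvectors.
Variables (F : comUnitRingType) (n : nat).
Implicit Types A M W V L : 'M[F]_n.

(** One-sided inverses of square matrices are two-sided, so [V *m (W *m M)] and [M *m V *m W] are
    also the identity; inserting them turns each equation into the other. *)
Lemma dual_eigenmx A M L W V : W *m M *m V = 1%:M ->
  (A *m V = M *m V *m L) <-> (W *m A = L *m W *m M).
Proof.
move=> WMV1; have VWM1 : V *m (W *m M) = 1%:M by exact: mulmx1C.
have MVW1 : M *m V *m W = 1%:M by apply: mulmx1C; rewrite mulmxA.
split=> [AV | WA].
- by rewrite -[LHS]mulmx1 -VWM1 mulmxA -(mulmxA W A) AV !mulmxA WMV1 mul1mx.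
- by rewrite -[LHS]mul1mx -MVW1 -!mulmxA (mulmxA W A) WA -!mulmxA
             [W *m _]mulmxA WMV1 mulmx1.
Qed.

Lemma eigenmx_gram_comm A M L W V :
  A *m V = M *m V *m L -> W *m A = L *m W *m M ->
  L *m (W *m M *m V) = W *m M *m V *m L.
Proof. by move=> AV WA; rewrite !mulmxA -WA -(mulmxA W A) AV !mulmxA. Qed.

End DualEigenvectors.

(** Entry [(i, j)] of the commutation relation reads [(L i i - L j j) * B i j = 0]. *)
Lemma comm_diag_mx_eq0 (F : idomainType) (n : nat) (L B : 'M[F]_n) (i j : 'I_n) :
  is_diag_mx L -> L *m B = B *m L -> L i i <> L j j -> B i j = 0.
Proof.
move=> /diag_mxP[d ->]; rewrite mul_diag_mx mul_mx_diag => /matrixP/(_ i j).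
rewrite !mxE !eqxx !mulr1n [RHS]mulrC => /eqP.
rewrite -subr_eq0 -mulrBl mulf_eq0 subr_eq0.
by case/orP=> /eqP.
Qed.

Section Eigenvectors.
Variables (C : numClosedFieldType) (n : nat).
Implicit Types A M L Vl Vr : 'M[C]_n.

Lemma unitmx_trmxC Vl : (Vl^t* \in unitmx) = (Vl \in unitmx).
Proof. by rewrite map_unitmx unitmx_tr. Qed.

Lemma eigenvectors_orthogonal A M L Vl Vr (i j : 'I_n) :
  right_eigenvectors A M L Vr -> left_eigenvectors A M L Vl ->
  L i i <> L j j ->
  (Vl^t* *m A *m Vr) i j = 0 /\ (Vl^t* *m M *m Vr) i j = 0.
Proof.
move=> [_ Ldiag AV] [_ _ WA] neqL.
have WMV0 := comm_diag_mx_eq0 Ldiag (eigenmx_gram_comm AV WA) neqL.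
(* [W A V = (W M V) L] only rescales the columns of [W M V], so its zeros carry over. *)
split=> //; rewrite -mulmxA AV !mulmxA.
by case/diag_mxP: Ldiag => d ->; rewrite mul_mx_diag mxE WMV0 mul0r.
Qed.

Lemma simple_eigenvalues_biorthogonal A M L Vl Vr :
  right_eigenvectors A M L Vr -> left_eigenvectors A M L Vl ->
  injective (fun i : 'I_n => L i i) -> biorthogonal A M Vl Vr.
Proof.
move=> rV lV injL.
have ortho (i j : 'I_n) : i != j :> nat ->
    (Vl^t* *m A *m Vr) i j = 0 /\ (Vl^t* *m M *m Vr) i j = 0.
  move=> /eqP neq_ij; apply: (eigenvectors_orthogonal rV lV) => /injL eq_ij.
  by apply: neq_ij; rewrite eq_ij.
exists (Vl^t* *m A *m Vr), (Vl^t* *m M *m Vr).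
by split=> //; apply/is_diag_mxP=> i j /ortho[].
Qed.

Lemma normalized_biorthogonal A M L Vl Vr :
  is_diag_mx L -> A *m Vr = M *m Vr *m L -> Vl^t* *m M *m Vr = 1%:M ->
  biorthogonal A M Vl Vr.
Proof.
move=> Ldiag AV WMV1; exists L, 1%:M; split=> //.
by rewrite -mulmxA AV !mulmxA WMV1 mul1mx.
Qed.

Lemma left_dual_eigenvectors A M L Vr : M \in unitmx ->
  right_eigenvectors A M L Vr ->
  exists2 Vl, left_eigenvectors A M L Vl & biorthogonal A M Vl Vr.
Proof.
move=> uM [uV Ldiag AV]; have uMV : M *m Vr \in unitmx by rewrite unitmx_mul uM.
(* This is the only choice with [Vl^t* *m M *m Vr = 1%:M]. *)
pose Vl := (invmx (M *m Vr))^t*.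
have WMV1 : Vl^t* *m M *m Vr = 1%:M by rewrite trmxCK -mulmxA mulVmx.
exists Vl; last exact: normalized_biorthogonal AV WMV1.
split=> //; first by rewrite unitmx_trmxC unitmx_inv.
exact/(dual_eigenmx _ _ WMV1).
Qed.

Lemma right_dual_eigenvectors A M L Vl : M \in unitmx ->
  left_eigenvectors A M L Vl ->
  exists2 Vr, right_eigenvectors A M L Vr & biorthogonal A M Vl Vr.
Proof.
move=> uM [uV Ldiag WA].
have uWM : Vl^t* *m M \in unitmx by rewrite unitmx_mul unitmx_trmxC uV.
have WMV1 := mulmxV uWM.
have AV := (dual_eigenmx A L WMV1).2 WA.
exists (invmx (Vl^t* *m M)); last exact: normalized_biorthogonal AV WMV1.
by split; rewrite ?unitmx_inv.
Qed.

(** Diagonalizability gives [P *m B = diag_mx d *m P] with [B = invmx M *m A]: the rows of [P] are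
    left eigenvectors of [B], hence the columns of [invmx P] are right ones. *)
Lemma diagonalizable_right_eigenvectors A M : M \in unitmx ->
  diagonalizable (invmx M *m A) -> exists L Vr, right_eigenvectors A M L Vr.
Proof.
move=> uM [P uP /diagonalizable_forPex[d]] /(simmxP uP) PB.
exists (diag_mx d), (invmx P); split; rewrite ?unitmx_inv //.
apply: (can_inj (mulKVmx uM)); rewrite -mulmxA mulKmx // mulmxA.
by apply: (can_inj (mulKmx uP)); rewrite mulmxA PB mulmxK // mulKVmx.
Qed.

End Eigenvectors.

(* With a repeated eigenvalue, two independently chosen eigenbases need not be
   biorthogonal (A = M = 1, Vr = 1, Vl not diagonal), because the equations
   fix Vl and Vr only up to a change of basis in each eigenspace.  Hence:
   arbitrary eigenbases are orthogonal across distinct eigenvalues, and are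
   biorthogonal when the eigenvalues are distinct; in general either eigenbasis
   may be arbitrary, the other being chosen accordingly. *)
Theorem lemma4p1 (R : realType) (n : nat) (A M : 'M[R[i]]_n)
    (M_unit : M \in unitmx) (MA_diag : diagonalizable (invmx M *m A)) :
  [/\ (exists L Vl Vr : 'M[R[i]]_n,
         [/\ right_eigenvectors A M L Vr, left_eigenvectors A M L Vl
           & biorthogonal A M Vl Vr]),
      (forall L Vl Vr : 'M[R[i]]_n,
         right_eigenvectors A M L Vr -> left_eigenvectors A M L Vl ->
         forall i j : 'I_n, L i i <> L j j ->
           (Vl^t* *m A *m Vr) i j = 0 /\ (Vl^t* *m M *m Vr) i j = 0),
      (forall L Vl Vr : 'M[R[i]]_n,
         right_eigenvectors A M L Vr -> left_eigenvectors A M L Vl ->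
         injective (fun i : 'I_n => L i i) -> biorthogonal A M Vl Vr),
      (forall L Vr : 'M[R[i]]_n, right_eigenvectors A M L Vr ->
         exists2 Vl : 'M[R[i]]_n,
           left_eigenvectors A M L Vl & biorthogonal A M Vl Vr)
    & (forall L Vl : 'M[R[i]]_n, left_eigenvectors A M L Vl ->
         exists2 Vr : 'M[R[i]]_n,
           right_eigenvectors A M L Vr & biorthogonal A M Vl Vr)].
Proof.
split.
- have [L [Vr rV]] := diagonalizable_right_eigenvectors M_unit MA_diag.
  have [Vl lV orthoV] := left_dual_eigenvectors M_unit rV.
  by exists L, Vl, Vr.
- by move=> L Vl Vr rV lV i j; apply: eigenvectors_orthogonal.
- by move=> L Vl Vr; apply: simple_eigenvalues_biorthogonal.
- by move=> L Vr; apply: left_dual_eigenvectors.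
- by move=> L Vl; apply: right_dual_eigenvectors.
Qed.
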